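(* Let $n$ be a positive integer and let $\mathbf{v}_1,\ldots,\mathbf{v}_m\in\mathbf{C}^{\otimes n}(A)$. Then there is an effective algorithm that computes \[r_m=\mathrm{rank}_{\mathbb{F}_q[t]}\mathrm{Span}_{\mathbb{F}_q[t]}\{\mathbf{v}_1,\ldots,\mathbf{v}_m\}.\]
   Context: $\mathbb{F}_q$ is the finite field with $q$ elements, $A=\mathbb{F}_q[\theta]$, $k=\mathbb{F}_q(\theta)$, $k_\infty=\mathbb{F}_q((1/\theta))$, $\mathbb{C}_\infty$ the completion of an algebraic closure of $k_\infty$. The $n$-th tensor power of the Carlitz module $\mathbf{C}^{\otimes n}$ is $\mathbb{C}_\infty^n$ with the $\mathbb{F}_q[t]$-module structure determined by $t\cdot x=(\theta I_n+N)x+Ex^{(q)}$, where $x^{(q)}$ raises each coordinate of $x$ to the $q$-th power, $N$ is the $n\times n$ matrix with $1$'s on the superdiagonal and $0$ elsewhere, and $E$ has a single $1$ in position $(n,1)$ and $0$ elsewhere. $\mathbf{C}^{\otimes n}(A)=A^n$ (integral points). The rank of a finitely generated $\mathbb{F}_q[t]$-module is the maximal number of $\mathbb{F}_q[t]$-linearly independent elements; the algorithm takes as input $n$ and the coordinates of $\mathbf{v}_1,\ldots,\mathbf{v}_m$ and outputs $r_m$. *)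

(* Defs.v *)
From HB Require Import structures.
From mathcomp Require Import all_boot all_order all_algebra.
From mathcomp Require Import all_fingroup all_solvable all_field.

Set Implicit Arguments.
Unset Strict Implicit.
Unset Printing Implicit Defensive.

Import GRing.Theory.
Local Open Scope ring_scope.

(* Algorithms are partial recursive functions, given by their defining
   schemes: [mu_rec k] is the type of schemes with [k] arguments. *)
Inductive mu_rec : nat -> Type :=
| MZero k : mu_rec k
| MSucc : mu_rec 1
| MProj k : 'I_k -> mu_rec k
| MComp k l : mu_rec l -> ('I_l -> mu_rec k) -> mu_rec k
| MRec k : mu_rec k -> mu_rec k.+2 -> mu_rec k.+1
| MMin k : mu_rec k.+1 -> mu_rec k.

(* [mu_eval e xs z]: the computation of [e] on [xs] halts with value [z]. In
   [MRec g h] the recursion variable comes first and [h] receives the counter,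
   the previous value [s i], then the parameters; [s] lists the successive
   values. In [MMin g], [g] must halt on every smaller candidate. *)
Fixpoint mu_eval k (e : mu_rec k) : k.-tuple nat -> nat -> Prop :=
  match e in mu_rec k return k.-tuple nat -> nat -> Prop with
  | MZero _ => fun _ z => z = 0%N
  | MSucc => fun xs z => z = (thead xs).+1
  | MProj _ i => fun xs z => z = tnth xs i
  | MComp _ l g hs => fun xs z =>
      exists2 ys : l.-tuple nat,
        forall i, mu_eval (hs i) xs (tnth ys i) & mu_eval g ys z
  | MRec _ g h => fun xs z =>
      exists s : nat -> nat,
        [/\ mu_eval g [tuple of behead xs] (s 0%N),
            forall i, (i < thead xs)%N ->
              mu_eval h [tuple of i :: s i :: behead xs] (s i.+1)
          & z = s (thead xs)]
  | MMin _ g => fun xs z =>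
      mu_eval g [tuple of z :: xs] 0%N /\
      forall y, (y < z)%N -> exists w, mu_eval g [tuple of y :: xs] w.+1
  end.

Lemma mu_eval_det k (e : mu_rec k) xs z1 z2 :
  mu_eval e xs z1 -> mu_eval e xs z2 -> z1 = z2.
Proof.
elim: e xs z1 z2 => {k}.
- by move=> k xs z1 z2 /= -> ->.
- by move=> xs z1 z2 /= -> ->.
- by move=> k i xs z1 z2 /= -> ->.
- move=> k l g IHg hs IHh xs z1 z2 /= [ys1 h1 g1] [ys2 h2 g2].
  suff eq_ys: ys1 = ys2 by apply: IHg g1 _; rewrite eq_ys.
  by apply: eq_from_tnth => i; apply: IHh (h1 i) (h2 i).
- move=> k g IHg h IHh xs z1 z2 /= [s1 [g1 h1 ->]] [s2 [g2 h2 ->]].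
  suff: forall i, (i <= thead xs)%N -> s1 i = s2 i by apply.
  elim=> [|i IHi] lt_i; first exact: IHg g1 g2.
  have eq_i := IHi (ltnW lt_i).
  by have := h1 i lt_i; rewrite eq_i => /IHh; apply; apply: h2.
move=> k g IHg xs z1 z2 /= [g1 lt1] [g2 lt2].
case: (ltngtP z1 z2) => // lt_z.
  by have [w /IHg/(_ g1)] := lt2 _ lt_z.
by have [w /IHg/(_ g2)] := lt1 _ lt_z.
Qed.

(* The points of the n-th tensor power of the Carlitz module over an
   F_q[theta]-algebra R, i.e., an F_q-algebra R with a distinguished element
   theta. The alias carries the F_q[t]-module structure defined below, which
   differs from the entrywise scaling of column vectors. *)
Definition carlitz_tensor (F : finFieldType) (R : comAlgType F) (theta : R)
  (n : nat) : Type := 'cV[R]_n.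

Section CarlitzTensor.

Variables (F : finFieldType) (R : comAlgType F) (theta : R) (n : nat).

Definition carlitz_N : 'M[R]_n := \matrix_(i, j) (i.+1 == j :> nat)%:R.

Definition carlitz_E : 'M[R]_n :=
  \matrix_(i, j) ((i.+1 == n :> nat) && (j == 0 :> nat))%:R.

Definition frob_col (x : 'cV[R]_n) : 'cV[R]_n :=
  map_mx (fun y => y ^+ #|F|) x.

Definition carlitz_t (x : 'cV[R]_n) : 'cV[R]_n :=
  (theta%:M + carlitz_N) *m x + carlitz_E *m frob_col x.

Definition carlitz_act (a : {poly F}) (x : 'cV[R]_n) : 'cV[R]_n :=
  \sum_(i < size a) (a`_i)%:A *: iter i carlitz_t x.

HB.instance Definition _ :=
  GRing.Zmodule.copy (carlitz_tensor theta n) 'cV[R]_n.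

Let pnat_cardF : [pchar R].-nat #|F|.
Proof.
have [p p_pr charFp] := finPcharP F.
have pF : p.-nat #|F|.
  by have /abelem_pgroup := fin_ring_pchar_abelem charFp; rewrite /pgroup cardsT.
by apply: sub_in_pnat pF => r _ /eqP ->; rewrite pchar_lalg.
Qed.

Let frob_colD : {morph frob_col : x y / x + y}.
Proof. by move=> x y; apply/matrixP=> i j; rewrite !mxE exprDn_pchar. Qed.

Let frob_colZ (c : F) (x : 'cV[R]_n) : frob_col (c%:A *: x) = c%:A *: frob_col x.
Proof.
apply/matrixP=> i j; rewrite !mxE exprMn; congr (_ * _).
by rewrite exprZn expr1n expf_card.
Qed.

Let carlitz_tD : {morph carlitz_t : x y / x + y}.
Proof. by move=> x y; rewrite /carlitz_t frob_colD !mulmxDr addrACA. Qed.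

Let carlitz_tZ (c : F) (x : 'cV[R]_n) : carlitz_t (c%:A *: x) = c%:A *: carlitz_t x.
Proof. by rewrite /carlitz_t frob_colZ -!scalemxAr scalerDr. Qed.

Let iterD i : {morph iter i carlitz_t : x y / x + y}.
Proof. by elim: i => // i IHi x y; rewrite !iterS IHi carlitz_tD. Qed.

Let act_widen m (a : {poly F}) x : (size a <= m)%N ->
  carlitz_act a x = \sum_(i < m) (a`_i)%:A *: iter i carlitz_t x.
Proof.
move=> le_am; rewrite /carlitz_act (big_ord_widen _ (fun i =>
  (a`_i)%:A *: iter i carlitz_t x) le_am) big_mkcond.
apply: eq_bigr => i _; case: ltnP => // le_ai.
by rewrite nth_default // !scale0r.
Qed.

Let actDr a : {morph carlitz_act a : x y / x + y}.
Proof.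
move=> x y; rewrite -big_split; apply: eq_bigr => i _.
by rewrite iterD scalerDr.
Qed.

Let actDl x : {morph carlitz_act^~ x : a b / a + b}.
Proof.
move=> a b; have [sa sb] := (leq_maxl (size a) (size b), leq_maxr (size a) (size b)).
rewrite !(@act_widen (maxn (size a) (size b))) ?size_polyD //.
rewrite -big_split; apply: eq_bigr => i _.
by rewrite coefD scalerDl scalerDl.
Qed.

Let actC c x : carlitz_act c%:P x = c%:A *: x.
Proof. by rewrite (@act_widen 1) ?size_polyC_leq1 // big_ord1 coefC. Qed.

Let actX a x : carlitz_act (a * 'X) x = carlitz_act a (carlitz_t x).
Proof.
have [-> | a_neq0] := eqVneq a 0; first by rewrite mul0r -!polyC0 !actC !scale0r.
rewrite (@act_widen (size a).+1) ?size_mulX // big_ord_recl coefMX !scale0r add0r.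
by apply: eq_bigr => i _; rewrite coefMX /= -iterSr.
Qed.

Let act_t a x : carlitz_act a (carlitz_t x) = carlitz_t (carlitz_act a x).
Proof.
have t0 : carlitz_t 0 = 0 by rewrite -(scale0r 0) -(scale0r 1) carlitz_tZ !scale0r.
rewrite /carlitz_act (big_morph _ carlitz_tD t0); apply: eq_bigr => i _.
by rewrite carlitz_tZ -iterSr.
Qed.

Let act1 : left_id 1 carlitz_act.
Proof. by move=> x; rewrite actC !scale1r. Qed.

Let actA a b x : carlitz_act a (carlitz_act b x) = carlitz_act (a * b) x.
Proof.
elim/poly_ind: a x => [|a c IHa] x.
  by rewrite mul0r -!polyC0 !actC !scale0r.
rewrite mulrDl !actDl actX -act_t IHa -mulrA ['X * b]mulrC mulrA actX.
congr (_ + _); rewrite actC mul_polyC (@act_widen (size b) (c *: b)) ?size_scale_leq //.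
rewrite scaler_sumr; apply: eq_bigr => i _.
by rewrite coefZ !scalerA -scalerAl mul1r scalerA.
Qed.

HB.instance Definition _ :=
  GRing.Zmodule_isLmodule.Build {poly F} (carlitz_tensor theta n)
    actA act1 actDr actDl.

Lemma carlitz_scaleE a (x : carlitz_tensor theta n) : a *: x = carlitz_act a x.
Proof. by []. Qed.

Lemma carlitz_scaleX (x : carlitz_tensor theta n) : 'X *: x = carlitz_t x.
Proof. by rewrite carlitz_scaleE -['X]mul1r actX act1. Qed.

End CarlitzTensor.

(* The integral points: here R = A = F_q[theta], so that the polynomial
   indeterminate stands for theta in coordinates and for t in scalars. *)
Definition carlitz_integral (F : finFieldType) (n : nat) : lmodType {poly F} :=
  carlitz_tensor ('X : {poly F}) n.

Section Rank.

Variables (S : nzRingType) (V : lmodType S).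

Definition span_of m (v : 'I_m -> V) (x : V) : Prop :=
  exists c : 'I_m -> S, x = \sum_i c i *: v i.

Definition lin_indep r (w : 'I_r -> V) : Prop :=
  forall c : 'I_r -> S, \sum_i c i *: w i = 0 -> forall i, c i = 0.

Definition has_rank (M : V -> Prop) (r : nat) : Prop :=
  (exists2 w : 'I_r -> V, forall i, M (w i) & lin_indep w) /\
  (forall k (w : 'I_k -> V), (forall i, M (w i)) -> lin_indep w -> (k <= r)%N).

End Rank.

(* Goedel numbering of the input. CodeSeq.code is an explicit bijection between
   seq nat and nat; the elements of F are numbered 0, ..., q - 1, and a
   polynomial is given by its coefficients, constant term first. *)
Section Encoding.

Variable F : finFieldType.

Definition code_poly (p : {poly F}) : nat :=
  CodeSeq.code [seq (enum_rank c : nat) | c <- p].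

Definition code_point n (x : carlitz_integral F n) : nat :=
  CodeSeq.code [seq code_poly ((x : 'cV[{poly F}]_n) i 0) | i <- enum 'I_n].

Definition code_points n m (v : 'I_m -> carlitz_integral F n) : nat :=
  CodeSeq.code [seq code_point (v i) | i <- enum 'I_m].

End Encoding.

(* Main.v *)
Require Import Defs.
From HB Require Import structures.
From mathcomp Require Import all_boot all_order all_algebra.
From mathcomp Require Import all_fingroup all_solvable all_field zify.
From Stdlib Require Import Classical.

(* Let M be the span of v_1, ..., v_m and s its rank. There is an exhaustive
   filtration B_0 <= B_1 <= ... of A^n by finite-dimensional F_q-spaces of
   vectors with bounded degrees such that x lies in B_j if and only if t x lies
   in B_(j+1). Hence elements of M in B_(j+1) that are F_q-independent modulo
   B_j are F_q[t]-independent, so that dim (M /\ B_j) <= dim B_0 + s j. If all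
   v_i lie in B_(J+1), the relations sum_i a_i v_i = 0 with deg a_i < L thus
   form a space of dimension at least (m - s) L - s J - dim B_0; this dimension
   is at most (m - s) L, because s of the v_i are independent. For
   L > s J + dim B_0 the rank is therefore read off the number of relations,
   and these are counted by enumeration: a relation is tested by Horner's rule
   with coefficients written as the base q digits of one natural number. *)

Set Implicit Arguments.
Unset Strict Implicit.
Unset Printing Implicit Defensive.

Import GRing.Theory.

(** * Primitive recursive functions *)

(** Searches are expressed below as bounded sums of truth values: quotients, 2-adic valuations,
    lengths and finally the rank are found by counting an initial segment. *)
Lemma sum_nat_ltn n c : n <= c -> \sum_(0 <= i < c) (i < n) = n.
Proof.
elim: c => [|c IHc]; first by rewrite leqn0 => /eqP->; rewrite big_nil.
rewrite leq_eqVlt => /orP[/eqP->|]; last first.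
  by rewrite ltnS => le_nc; rewrite big_nat_recr //= IHc // ltnNge le_nc addn0.
rewrite big_nat (eq_bigr (fun=> 1)) => [|i /andP[_ ->]] //.
by rewrite -big_nat sum_nat_const_nat subn0 muln1.
Qed.

(** Functions take plain sequences and read their arguments by [nth 0], so that goals about composed
    functions carry no dependent types; only values on k-tuples matter. *)
Definition mu_computes k (f : seq nat -> nat) : Prop :=
  exists e : mu_rec k, forall xs : k.-tuple nat, mu_eval e xs (f xs).

Definition computable1 (f : nat -> nat) :=
  mu_computes 1 (fun s => f (nth 0 s 0)).
Definition computable2 (f : nat -> nat -> nat) :=
  mu_computes 2 (fun s => f (nth 0 s 0) (nth 0 s 1)).
Definition computable4 (f : nat -> nat -> nat -> nat -> nat) :=
  mu_computes 4 (fun s => f (nth 0 s 0) (nth 0 s 1) (nth 0 s 2) (nth 0 s 3)).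
Definition computable5 (f : nat -> nat -> nat -> nat -> nat -> nat) :=
  mu_computes 5 (fun s => f (nth 0 s 0) (nth 0 s 1) (nth 0 s 2) (nth 0 s 3)
    (nth 0 s 4)).
Definition computable6 (f : nat -> nat -> nat -> nat -> nat -> nat -> nat) :=
  mu_computes 6 (fun s => f (nth 0 s 0) (nth 0 s 1) (nth 0 s 2) (nth 0 s 3)
    (nth 0 s 4) (nth 0 s 5)).

Lemma mu_computes_ext k f g :
  (forall s, f s = g s) -> mu_computes k f -> mu_computes k g.
Proof. by move=> fg [e He]; exists e => xs; rewrite -fg. Qed.

Lemma mu_computes_comp k l g (h : 'I_l -> seq nat -> nat) :
  mu_computes l g -> (forall i, mu_computes k (h i)) ->
  mu_computes k (fun s => g [tuple h i s | i < l]).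
Proof.
move=> [eg Hg] /fin_all_exists [eh Hh].
exists (MComp eg eh) => xs /=; exists [tuple h i xs | i < l]; last exact: Hg.
by move=> i; rewrite tnth_mktuple.
Qed.

(** Bodies of sums and recursions see their bound variables in front of the parameters; d counts the
    entries skipped to reach the parameters again. *)
Lemma mu_computes_nth k d j : d + j < k ->
  mu_computes k (fun s => nth 0 (iter d behead s) j).
Proof.
move=> lt_jk; exists (MProj (Ordinal lt_jk)) => xs /=.
rewrite (tnth_nth 0) /=; elim: d j {lt_jk} => // d IHd j.
by rewrite iterS nth_behead IHd addSnnS.
Qed.

Lemma mu_computes_call k g (hs : seq (seq nat -> nat)) :
  mu_computes (size hs) g ->
  (forall i, i < size hs -> mu_computes k (nth (fun=> 0) hs i)) ->
  mu_computes k (fun s => g [seq h s | h <- hs]).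
Proof.
move=> Cg Chs; have [|e He] := @mu_computes_comp k _ g
  (fun i : 'I_(size hs) => nth (fun=> 0) hs i) Cg; first by move=> i; apply: Chs.
exists e => xs; have := He xs; congr mu_eval; congr g.
apply: (@eq_from_nth _ 0) => [|i]; first by rewrite [RHS]size_map; apply: size_tuple.
rewrite size_map size_enum_ord => lt_i.
by rewrite (nth_mktuple _ 0 (Ordinal lt_i)) (nth_map (fun=> 0)).
Qed.

Lemma mu_computes_call1 k g a : computable1 g -> mu_computes k a ->
  mu_computes k (fun s => g (a s)).
Proof. by move=> Cg ?; apply: (mu_computes_call (hs := [:: a]) Cg) => -[]. Qed.

Lemma mu_computes_call2 k g a b : computable2 g -> mu_computes k a ->
  mu_computes k b -> mu_computes k (fun s => g (a s) (b s)).
Proof.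
by move=> Cg ? ?; apply: (mu_computes_call (hs := [:: a; b]) Cg) => -[|[]].
Qed.

Lemma mu_computes_call4 k g a b c d : computable4 g -> mu_computes k a ->
  mu_computes k b -> mu_computes k c -> mu_computes k d ->
  mu_computes k (fun s => g (a s) (b s) (c s) (d s)).
Proof.
move=> Cg ? ? ? ?; apply: (mu_computes_call (hs := [:: a; b; c; d]) Cg).
by case=> [|[|[|[]]]].
Qed.

Lemma mu_computes_call5 k g a b c d e : computable5 g -> mu_computes k a ->
  mu_computes k b -> mu_computes k c -> mu_computes k d -> mu_computes k e ->
  mu_computes k (fun s => g (a s) (b s) (c s) (d s) (e s)).
Proof.
move=> Cg ? ? ? ? ?; apply: (mu_computes_call (hs := [:: a; b; c; d; e]) Cg).
by case=> [|[|[|[|[]]]]].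
Qed.

Lemma mu_computes_call6 k g a b c d e f : computable6 g -> mu_computes k a ->
  mu_computes k b -> mu_computes k c -> mu_computes k d -> mu_computes k e ->
  mu_computes k f -> mu_computes k (fun s => g (a s) (b s) (c s) (d s) (e s) (f s)).
Proof.
move=> Cg ? ? ? ? ? ?; apply: (mu_computes_call (hs := [:: a; b; c; d; e; f]) Cg).
by case=> [|[|[|[|[|[]]]]]].
Qed.

Lemma mu_computes_rec k a g (h : nat -> nat -> seq nat -> nat) :
  mu_computes k a -> mu_computes k g ->
  mu_computes k.+2 (fun s => h (nth 0 s 0) (nth 0 s 1) (behead (behead s))) ->
  mu_computes k (fun s => nat_rect (fun=> nat) (g s) (fun i r => h i r s) (a s)).
Proof.
move=> Ca [eg Hg] [eh Hh].
pose f s := nat_rect (fun=> nat) (g (behead s))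
  (fun i r => h i r (behead s)) (nth 0 s 0).
have Cf : mu_computes k.+1 f.
  exists (MRec eg eh) => xs /=.
  exists (nat_rect (fun=> nat) (g (behead xs)) (fun i r => h i r (behead xs))).
  split; first exact: (Hg [tuple of behead xs]).
    move=> i _.
    exact: (Hh [tuple of i :: nat_rect (fun=> nat) (g (behead xs))
       (fun i r => h i r (behead xs)) i :: behead xs]).
  by rewrite /thead (tnth_nth 0).
(* [MRec] recurses on its first argument; [arg] puts [a s] in front of the entries of s. *)
pose arg (i : 'I_k.+1) : seq nat -> nat :=
  if val i is j.+1 then nth 0 ^~ j else a.
have Carg i : mu_computes k (arg i).
  by case: i => [[|j] lt_jk] //=; rewrite /arg /=; apply: (@mu_computes_nth k 0 j).
have [e He] := mu_computes_comp Cf Carg; exists e => xs.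
suff <- : f [tuple arg i xs | i < k.+1] =
    nat_rect (fun=> nat) (g xs) (fun i r => h i r xs) (a xs) by apply: He.
suff -> : [tuple arg i xs | i < k.+1] = [tuple of a xs :: xs] by [].
apply: eq_from_tnth => i; rewrite tnth_mktuple (tnth_nth 0) /arg.
by case: i => [[|j] lt_jk].
Qed.

Lemma computable_succn : computable1 succn.
Proof. by exists MSucc => xs /=; rewrite /thead (tnth_nth 0). Qed.

Lemma mu_computes_const k c : mu_computes k (fun=> c).
Proof.
elim: c => [|c IHc]; first by exists (MZero k).
exact: (mu_computes_call1 computable_succn IHc).
Qed.

Ltac comp_var :=
  lazymatch goal with
  | |- mu_computes _ (fun s => nth 0 s ?j) => exact: (@mu_computes_nth _ 0 j)
  | |- mu_computes _ (fun s => nth 0 (behead s) ?j) => exact: (@mu_computes_nth _ 1 j)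
  | |- mu_computes _ (fun s => nth 0 (behead (behead s)) ?j) =>
     exact: (@mu_computes_nth _ 2 j)
  | |- mu_computes _ (fun s => nth 0 (behead (behead (behead s))) ?j) =>
     exact: (@mu_computes_nth _ 3 j)
  | |- mu_computes _ (fun s => nth 0 (behead (behead (behead (behead s)))) ?j) =>
     exact: (@mu_computes_nth _ 4 j)
  end.

Lemma computable_addn : computable2 addn.
Proof.
apply: (@mu_computes_ext _ (fun s => nat_rect (fun=> nat) (nth 0 s 0)
  (fun _ r => r.+1) (nth 0 s 1))) => [s|].
  by elim: (nth 0 s 1) => [|i IHi] /=; rewrite ?addn0 // IHi addnS.
apply: (@mu_computes_rec _ _ _ (fun _ r _ => r.+1)); try comp_var.
apply: (mu_computes_call1 computable_succn); comp_var.
Qed.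

Lemma computable_predn : computable1 predn.
Proof.
apply: (@mu_computes_ext _ (fun s => nat_rect (fun=> nat) 0
  (fun i _ => i) (nth 0 s 0))) => [s|]; first by case: (nth 0 s 0).
apply: (@mu_computes_rec _ _ _ (fun i _ _ => i)); try comp_var.
exact: mu_computes_const.
Qed.

Lemma computable_subn : computable2 subn.
Proof.
apply: (@mu_computes_ext _ (fun s => nat_rect (fun=> nat) (nth 0 s 0)
  (fun _ r => r.-1) (nth 0 s 1))) => [s|].
  by elim: (nth 0 s 1) => [|i IHi] /=; rewrite ?subn0 // IHi subnS.
apply: (@mu_computes_rec _ _ _ (fun _ r _ => r.-1)); try comp_var.
apply: (mu_computes_call1 computable_predn); comp_var.
Qed.

Lemma mu_computes_sum k a (f : nat -> seq nat -> nat) :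
  mu_computes k a -> mu_computes k.+1 (fun s => f (nth 0 s 0) (behead s)) ->
  mu_computes k (fun s => \sum_(0 <= i < a s) f i s).
Proof.
move=> Ca Cf.
apply: (@mu_computes_ext _ (fun s => nat_rect (fun=> nat) 0
  (fun i r => r + f i s) (a s))) => [s|].
  by elim: (a s) => [|i IHi] /=; rewrite ?big_nil ?big_nat_recr //= -IHi.
apply: (@mu_computes_rec _ _ _ (fun i r s => r + f i s)) => //.
  exact: mu_computes_const.
apply: (mu_computes_call2 computable_addn); first by comp_var.
(* The body of the recursion receives the counter, the accumulator and then s; [arg] skips the
   accumulator, on which f does not depend. *)
pose arg (i : 'I_k.+1) : seq nat -> nat :=
  nth 0 ^~ (if val i is j.+1 then j.+2 else 0).
have Carg i : mu_computes k.+2 (arg i).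
  rewrite /arg; apply: (@mu_computes_nth k.+2 0).
  by case: i => [[|j] lt_jk].
have [e He] := mu_computes_comp Cf Carg; exists e => xs.
have /= := He xs; case/tupleP: xs {He} => x xs; case/tupleP: xs => y xs /=.
rewrite (nth_mktuple _ 0 (ord0 : 'I_k.+1)) /= /arg /=.
congr mu_eval; congr f.
apply: (@eq_from_nth _ 0) => [|j].
  by rewrite size_behead size_map size_enum_ord size_tuple.
rewrite size_behead size_map size_enum_ord => lt_jk; rewrite nth_behead.
by rewrite (nth_mktuple _ 0 (@Ordinal k.+1 j.+1 lt_jk)).
Qed.

Lemma computable_muln : computable2 muln.
Proof.
apply: (@mu_computes_ext _ (fun s => \sum_(0 <= i < nth 0 s 0) nth 0 s 1)) => [s|].
  by rewrite sum_nat_const_nat subn0.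
by apply: mu_computes_sum; comp_var.
Qed.

Lemma computable_expn : computable2 expn.
Proof.
apply: (@mu_computes_ext _ (fun s => nat_rect (fun=> nat) 1
  (fun _ r => nth 0 s 0 * r) (nth 0 s 1))) => [s|].
  by elim: (nth 0 s 1) => [|i IHi] //=; rewrite expnS IHi.
apply: (@mu_computes_rec _ _ _ (fun _ r s => nth 0 s 0 * r)); try comp_var.
  exact: mu_computes_const.
by apply: (mu_computes_call2 computable_muln); comp_var.
Qed.

Lemma computable_leq : computable2 (fun a b => a <= b).
Proof.
apply: (@mu_computes_ext _ (fun s => 1 - (nth 0 s 0 - nth 0 s 1))) => [s|].
  by case: leqP => [/eqP-> // | ]; rewrite -subn_gt0; case: (_ - _) => [|[]].
apply: (mu_computes_call2 computable_subn); first exact: mu_computes_const.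
by apply: (mu_computes_call2 computable_subn); comp_var.
Qed.

Lemma computable_eqn : computable2 (fun a b => a == b).
Proof.
apply: (@mu_computes_ext _ (fun s =>
  (nth 0 s 0 <= nth 0 s 1) * (nth 0 s 1 <= nth 0 s 0))) => [s|].
  by rewrite mulnb -eqn_leq.
by apply: (mu_computes_call2 computable_muln);
  apply: (mu_computes_call2 computable_leq); comp_var.
Qed.

Lemma mu_computes_if k (b : seq nat -> bool) f g :
  mu_computes k (fun s => b s) -> mu_computes k f -> mu_computes k g ->
  mu_computes k (fun s => if b s then f s else g s).
Proof.
move=> Cb Cf Cg.
apply: (@mu_computes_ext _ (fun s => b s * f s + (1 - b s) * g s)) => [s|].
  by case: (b s); rewrite ?mul1n ?addn0 ?mul0n.
apply: (mu_computes_call2 computable_addn).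
  exact: (mu_computes_call2 computable_muln).
apply: (mu_computes_call2 computable_muln) => //.
by apply: (mu_computes_call2 computable_subn) => //; apply: mu_computes_const.
Qed.

Lemma computable_divn : computable2 divn.
Proof.
(* The quotient counts the positive multiples of the divisor up to the dividend. For divisor 0 that
   count would return the dividend instead of 0. *)
apply: (@mu_computes_ext _ (fun s => if nth 0 s 1 <= 0 then 0 else
  \sum_(0 <= i < nth 0 s 0) (i.+1 * nth 0 s 1 <= nth 0 s 0))) => [s|].
  set a := nth 0 s 0; case: (posnP (nth 0 s 1)) => [->|b_gt0].
    by rewrite divn0.
  rewrite leqNgt b_gt0 /=.
  under eq_bigr => i _ do rewrite -leq_divRL //.
  by rewrite sum_nat_ltn ?leq_div.
apply: mu_computes_if; try exact: mu_computes_const.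
  by apply: (mu_computes_call2 computable_leq); first comp_var;
    apply: mu_computes_const.
apply: mu_computes_sum; first comp_var.
apply: (mu_computes_call2 computable_leq); last comp_var.
apply: (mu_computes_call2 computable_muln); last comp_var.
by apply: (mu_computes_call1 computable_succn); comp_var.
Qed.

Lemma computable_modn : computable2 modn.
Proof.
apply: (@mu_computes_ext _ (fun s =>
  nth 0 s 0 - nth 0 s 0 %/ nth 0 s 1 * nth 0 s 1)) => [s|].
  by rewrite {1}(divn_eq (nth 0 s 0) (nth 0 s 1)) addKn.
apply: (mu_computes_call2 computable_subn); first comp_var.
apply: (mu_computes_call2 computable_muln); last comp_var.
by apply: (mu_computes_call2 computable_divn); comp_var.
Qed.

Lemma computable_minn : computable2 minn.
Proof.
apply: (@mu_computes_ext _ (fun s => nth 0 s 0 - (nth 0 s 0 - nth 0 s 1))) => [s|].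
  by rewrite minnE.
apply: (mu_computes_call2 computable_subn); first comp_var.
by apply: (mu_computes_call2 computable_subn); comp_var.
Qed.

(** Such an f is constant from N on, hence a finite table that can be written into the scheme. The
    operations of F become computable this way, whatever F is. *)
Lemma computable_finite1 N f : (forall a, f (minn a N) = f a) -> computable1 f.
Proof.
move=> fN; suff Cn n : mu_computes 1 (fun s =>
    \sum_(i < n) (i == minn (nth 0 s 0) N :> nat) * f i).
  apply: mu_computes_ext (Cn N.+1) => s; rewrite -fN.
  have lt_aN : minn (nth 0 s 0) N < N.+1 by rewrite ltnS geq_minr.
  rewrite (bigD1 (Ordinal lt_aN)) //= eqxx mul1n big1 ?addn0 // => i.
  by rewrite -val_eqE /= => /negPf->.
elim: n => [|n IHn].
  by apply: mu_computes_ext (mu_computes_const 1 0) => s; rewrite big_ord0.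
apply: (@mu_computes_ext _ (fun s => \sum_(i < n) (i == minn (nth 0 s 0) N :> nat) * f i
  + (n == minn (nth 0 s 0) N) * f n)) => [s|]; first by rewrite big_ord_recr.
apply: (mu_computes_call2 computable_addn) => //.
apply: (mu_computes_call2 computable_muln); last exact: mu_computes_const.
apply: (mu_computes_call2 computable_eqn); first exact: mu_computes_const.
by apply: (mu_computes_call2 computable_minn);
  [comp_var | apply: mu_computes_const].
Qed.

Lemma computable_finite2 N f :
  (forall a b, f (minn a N) b = f a b) -> (forall a, computable1 (f a)) ->
  computable2 f.
Proof.
move=> fN Cf; suff Cn n : mu_computes 2 (fun s =>
    \sum_(i < n) (i == minn (nth 0 s 0) N :> nat) * f i (nth 0 s 1)).
  apply: mu_computes_ext (Cn N.+1) => s; rewrite -fN.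
  have lt_aN : minn (nth 0 s 0) N < N.+1 by rewrite ltnS geq_minr.
  rewrite (bigD1 (Ordinal lt_aN)) //= eqxx mul1n big1 ?addn0 // => i.
  by rewrite -val_eqE /= => /negPf->.
elim: n => [|n IHn].
  by apply: mu_computes_ext (mu_computes_const 2 0) => s; rewrite big_ord0.
apply: (@mu_computes_ext _ (fun s => \sum_(i < n) (i == minn (nth 0 s 0) N :> nat)
  * f i (nth 0 s 1) + (n == minn (nth 0 s 0) N) * f n (nth 0 s 1))) => [s|].
  by rewrite big_ord_recr.
apply: (mu_computes_call2 computable_addn) => //.
apply: (mu_computes_call2 computable_muln); last first.
  by apply: (mu_computes_call1 (Cf n)); comp_var.
apply: (mu_computes_call2 computable_eqn); first exact: mu_computes_const.
by apply: (mu_computes_call2 computable_minn);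
  [comp_var | apply: mu_computes_const].
Qed.

(** A hook for [computability], redefined before each new function to list the functions already
    known to be computable that occur in it. *)
Ltac computable_call := fail.

Ltac computability := cbv beta; lazymatch goal with
  | |- mu_computes _ (fun s => nth 0 _ _) => comp_var
  | |- mu_computes _ (fun s => S _) =>
     apply: (mu_computes_call1 computable_succn); computability
  | |- mu_computes _ (fun s => predn _) =>
     apply: (mu_computes_call1 computable_predn); computability
  | |- mu_computes _ (fun s => addn _ _) =>
     apply: (mu_computes_call2 computable_addn); computability
  | |- mu_computes _ (fun s => subn _ _) =>
     apply: (mu_computes_call2 computable_subn); computability
  | |- mu_computes _ (fun s => muln _ _) =>
     apply: (mu_computes_call2 computable_muln); computability
  | |- mu_computes _ (fun s => expn _ _) =>
     apply: (mu_computes_call2 computable_expn); computability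
  | |- mu_computes _ (fun s => divn _ _) =>
     apply: (mu_computes_call2 computable_divn); computability
  | |- mu_computes _ (fun s => modn _ _) =>
     apply: (mu_computes_call2 computable_modn); computability
  | |- mu_computes _ (fun s => nat_of_bool (leq _ _)) =>
     apply: (mu_computes_call2 computable_leq); computability
  | |- mu_computes _ (fun s => nat_of_bool (eq_op _ _)) =>
     apply: (mu_computes_call2 computable_eqn); computability
  | |- mu_computes _ (fun s => if _ then _ else _) =>
     apply: mu_computes_if; computability
  | |- mu_computes _ (fun s => bigop _ _ _) =>
     apply: mu_computes_sum; computability
  | |- mu_computes _ (fun s => nat_rect _ _ _ _) =>
     apply: mu_computes_rec; computability
  | _ => first [exact: mu_computes_const | computable_call; computability]
  end.

(** * Rank of a finitely generated module *)

Section ModuleRank.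

Variables (S : idomainType) (V : lmodType S).
Local Open Scope ring_scope.

(** Gaussian elimination without division, by induction on the number of columns: a zero first
    column is dropped, and otherwise a nonzero entry of it serves as pivot. *)
Lemma left_kernel_neq0 k s (C : 'M[S]_(k, s)) : (s < k)%N ->
  exists2 c : 'rV[S]_k, c != 0 & c *m C = 0.
Proof.
elim: s k C => [|s IHs] [|k] C // lt_sk.
  exists (const_mx 1); last by apply/matrixP=> ? [].
  by apply/eqP => /matrixP/(_ 0 0); rewrite !mxE => /eqP; rewrite oner_eq0.
pose C1 := (C : 'M_(k.+1, 1 + s)).
have [C0|] := eqVneq (lsubmx C1) 0.
  have [|c c0 cC] := IHs _ (rsubmx C1); first exact: ltnW.
  have cC1 : c *m C1 = 0 by rewrite -[C1]hsubmxK mul_mx_row C0 mulmx0 cC row_mx0.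
  by exists c.
case/cV0Pn => i; rewrite mxE /= => p_neq0; set p := C1 i _ in p_neq0.
(* Each remaining row is multiplied by p before a multiple of the pivot row is subtracted. A kernel
   vector of [D] lifts after scaling by p, and its entry at i is chosen to kill the first column. *)
pose D : 'M_(k, s) := \matrix_(a, b) (p * C1 (lift i a) (rshift 1 b)
  - C1 (lift i a) (lshift s 0) * C1 i (rshift 1 b)).
have [|c' c'_neq0 c'D] := IHs _ D; first by rewrite -ltnS.
pose c : 'rV_k.+1 := \row_a (if unlift i a is Some b then p * c' 0 b
  else - \sum_b c' 0 b * C1 (lift i b) (lshift s 0)).
have ci : c 0 i = - \sum_b c' 0 b * C1 (lift i b) (lshift s 0).
  by rewrite mxE unlift_none.
have cl b : c 0 (lift i b) = p * c' 0 b by rewrite mxE liftK.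
exists c.
  apply: contraNneq c'_neq0 => c_eq0; apply/eqP/rowP=> b; rewrite mxE.
  by apply/eqP; have /eqP := cl b; rewrite c_eq0 mxE eq_sym mulf_eq0 (negPf p_neq0).
suff: c *m C1 = 0 by [].
apply/rowP => j; rewrite !mxE (bigD1_ord i) //= ci.
under eq_bigr => b _ do rewrite cl.
rewrite -(splitK j); case: (split j) => [a|b] /=.
  rewrite (ord1 a) mulNr mulr_suml addrC -sumrB big1 // => b _.
  by apply/eqP; rewrite subr_eq0 [eqbRHS]mulrC mulrA.
have /rowP/(_ b) := c'D; rewrite !mxE => cD; rewrite -[RHS]cD.
rewrite mulNr mulr_suml addrC -sumrB.
by apply: eq_bigr => a _; rewrite mxE mulrBr !mulrA [p * _]mulrC.
Qed.

(** Coefficients are indexed by all of ['I_m] and supported in I, so that enlarging I requires no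
    reindexing. *)
Definition indep_on m (v : 'I_m -> V) (I : {set 'I_m}) : Prop :=
  forall c : 'I_m -> S, (forall i, i \notin I -> c i = 0) ->
    \sum_i c i *: v i = 0 -> forall i, c i = 0.

(** Independence is not decided here, hence the excluded middle; it enters the proof of correctness
    only and not the algorithm. *)
Lemma exists_maximal_indep_on m (v : 'I_m -> V) :
  exists2 I, indep_on v I & forall i, i \notin I -> ~ indep_on v (i |: I).
Proof.
have: indep_on v set0 by move=> c c0 _ i; apply: c0; rewrite inE.
have [k] := ubnP #|~: (set0 : {set 'I_m})|.
elim: k (set0 : {set 'I_m}) => // k IHk I leIk freeI.
have [maxI | ] := classic (forall i, i \notin I -> ~ indep_on v (i |: I)).
  by exists I.
move=> /not_all_ex_not[i notmax].
have [notIi /NNPP freeIi] := imply_to_and _ _ notmax.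
apply: IHk freeIi; rewrite -ltnS (leq_trans _ leIk) // ltnS.
apply: proper_card; rewrite properE !setCS subsetUr /=.
by apply/subsetPn; exists i; rewrite ?inE ?eqxx.
Qed.

(** By maximality every generator has a nonzero multiple in the span of the subfamily. A common
    denominator e moves any k elements of the module into that span, and for k > |I| a kernel vector
    of their coefficient matrix gives a relation. *)
Lemma has_rank_maximal_indep_on m (v : 'I_m -> V) (I : {set 'I_m}) :
  indep_on v I -> (forall i, i \notin I -> ~ indep_on v (i |: I)) ->
  has_rank (span_of v) #|I|.
Proof.
move=> freeI maxI.
have spanI (c : 'I_m -> S) : (forall i, i \notin I -> c i = 0) ->
    \sum_i c i *: v i = \sum_(j < #|I|) c (enum_val j) *: v (enum_val j).
  move=> cI; rewrite -(big_enum_val (fun i => c i *: v i)) /= [LHS](bigID (mem I)) /=.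
  by rewrite [X in _ + X]big1 ?addr0 // => i /cI ->; rewrite scale0r.
split.
  exists (fun j => v (enum_val j)) => [j|c sum0 j].
    exists (fun i => (i == enum_val j)%:R).
    rewrite (bigD1 (enum_val j)) //= eqxx scale1r big1 ?addr0 // => i /negPf->.
    by rewrite scale0r.
  pose c' i := \sum_(j < #|I| | enum_val j == i) c j.
  have c'E a : c' (enum_val a) = c a.
    rewrite /c' (eq_bigl (pred1 a)) ?big_pred1_eq // => b /=.
    exact: (inj_eq enum_val_inj).
  have c'I i : i \notin I -> c' i = 0.
    move=> notIi; apply: big_pred0 => b.
    by apply: contraNF notIi => /eqP <-; apply: enum_valP.
  rewrite -c'E; apply: freeI; first exact: c'I.
  rewrite (spanI _ c'I).
  by rewrite -[RHS]sum0; apply: eq_bigr => a _; rewrite c'E.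
(* Every generator is torsion modulo the span of the maximal free subfamily. *)
have torsion i : exists d, d != 0 /\ exists c : 'I_#|I| -> S,
    d *: v i = \sum_j c j *: v (enum_val j).
  have [Ii | notIi] := boolP (i \in I).
    exists 1; split; first exact: oner_neq0.
    exists (fun j => (j == enum_rank_in Ii i)%:R).
    rewrite (bigD1 (enum_rank_in Ii i)) //= eqxx enum_rankK_in // big1 ?addr0 //.
    by move=> j /negPf->; rewrite scale0r.
  have /not_all_ex_not[c dep] := maxI i notIi.
  have [c_supp {}dep] := imply_to_and _ _ dep.
  have [sum0 nz] := imply_to_and _ _ dep.
  exists (- c i); split.
    rewrite oppr_eq0; apply: contra_notN nz => /eqP ci0.
    apply: freeI => // j notIj; have [-> //|neq_ji] := eqVneq j i.
    by apply: c_supp; rewrite !inE negb_or neq_ji.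
  pose c' j := if j == i then 0 else c j.
  exists (fun j => c' (enum_val j)); rewrite -spanI.
    move: sum0; rewrite (bigD1 i) //= => /eqP; rewrite addr_eq0 scaleNr => /eqP->.
    rewrite opprK [RHS](bigD1 i) //= /c' eqxx scale0r add0r.
    by apply: eq_bigr => j /negPf->.
  move=> j notIj; rewrite /c'; case: eqVneq => // neq_ji.
  by apply: c_supp; rewrite !inE negb_or neq_ji.
have [d /all_and2[d_neq0 /fin_all_exists[c dv]]] := fin_all_exists torsion.
move=> k w /fin_all_exists[b wE] freew; rewrite leqNgt; apply/negP => lt_Ik.
(* Row l of [C] expresses e w_l in the subfamily; the factor of e belonging to i is absorbed by the
   relation for v_i. *)
pose e := \prod_i d i.
have e_neq0 : e != 0 by apply/prodf_neq0 => i _.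
pose C : 'M[S]_(k, #|I|) := \matrix_(l, j)
  \sum_i b l i * (\prod_(i' | i' != i) d i') * c i j.
have ew l : e *: w l = \sum_j C l j *: v (enum_val j).
  rewrite wE scaler_sumr.
  under [RHS]eq_bigr => j _ do rewrite mxE scaler_suml.
  rewrite exchange_big /=; apply: eq_bigr => i _.
  under eq_bigr => j _ do rewrite -scalerA.
  rewrite -scaler_sumr -dv !scalerA; congr (_ *: _).
  by rewrite mulrC /e (bigD1 i) //= -!mulrA [d i * _]mulrC.
have [u u_neq0 uC] := left_kernel_neq0 C lt_Ik.
have ue0 : forall l, u 0 l * e = 0.
  apply: freew; under eq_bigr => l _ do rewrite -scalerA ew scaler_sumr.
  rewrite exchange_big /= big1 // => j _.
  under eq_bigr => l _ do rewrite scalerA.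
  have /rowP/(_ j) := uC; rewrite !mxE -scaler_suml => ->.
  by rewrite scale0r.
case/negP: u_neq0; apply/eqP/rowP=> l; rewrite mxE; apply/eqP.
by have /eqP := ue0 l; rewrite mulf_eq0 (negPf e_neq0) orbF.
Qed.
End ModuleRank.

(** * The degree filtration *)

Section DegreeFiltration.

Variables (F : finFieldType) (n : nat).
Local Notation q := #|F|.
Local Notation V := (carlitz_integral F n.+1).
Local Open Scope ring_scope.

(** Natural number indices let i + 1 be written without casts; only indices up to n are meant. *)
Definition coord_at (x : V) (i : nat) : {poly F} :=
  (x : 'cV[{poly F}]_n.+1) (inord i) 0.

Lemma coord_atE (x : V) (i : 'I_n.+1) :
  coord_at x i = (x : 'cV[{poly F}]_n.+1) i 0.
Proof. by rewrite /coord_at inord_val. Qed.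

Lemma coord_at_inj (x y : V) :
  (forall i, (i <= n)%N -> coord_at x i = coord_at y i) -> x = y.
Proof.
move=> xy; apply/colP => i; rewrite -!coord_atE; apply: xy.
by rewrite -ltnS.
Qed.

Lemma coord_at0 i : coord_at 0 i = 0.
Proof.
have H (j : 'I_n.+1) : (0 : 'cV[{poly F}]_n.+1) j 0 = 0 by rewrite mxE.
exact: H.
Qed.

Lemma coord_atD x y i : coord_at (x + y) i = coord_at x i + coord_at y i.
Proof.
have H (j : 'I_n.+1) (a b : 'cV[{poly F}]_n.+1) : (a + b) j 0 = a j 0 + b j 0.
  by rewrite mxE.
exact: H.
Qed.

Lemma coord_at_sum I (r : seq I) P (f : I -> V) i :
  coord_at (\sum_(k <- r | P k) f k) i = \sum_(k <- r | P k) coord_at (f k) i.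
Proof.
apply: (big_morph (coord_at^~ i)); last exact: coord_at0.
by move=> x y; apply: coord_atD.
Qed.

Lemma coord_atZ (c : F) x i : coord_at (c%:P *: x) i = c *: coord_at x i.
Proof.
rewrite carlitz_scaleE /carlitz_act size_polyC.
have [->|c0] := eqVneq c 0.
  by rewrite big_ord0 scale0r coord_at0.
by rewrite big_ord1 /= coefC eqxx /coord_at mxE -scalerAl mul1r.
Qed.

Lemma coord_at_t x i : (i <= n)%N ->
  coord_at ('X *: x) i = 'X * coord_at x i +
    (if (i < n)%N then coord_at x i.+1 else coord_at x 0 ^+ q).
Proof.
move=> le_in; rewrite carlitz_scaleX /coord_at /carlitz_t mulmxDl mul_scalar_mx.
rewrite !mxE -addrA; congr (_ + _); have [lt_in|] := ltnP i n.
  rewrite (bigD1 (inord i.+1)) //= mxE !inordK // eqxx mul1r big1 => [|j neq_j].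
    rewrite addr0 big1 ?addr0 // => j _.
    by rewrite mxE inordK // eqSS ltn_eqF // mul0r.
  rewrite mxE inordK // (_ : (i.+1 == j :> nat) = false) ?mul0r //.
  by apply: contra_neqF neq_j => /eqP->; rewrite inord_val.
move=> le_ni; have {le_in le_ni} -> : i = n by apply/eqP; rewrite eqn_leq le_in.
rewrite big1 ?add0r => [|j _]; last first.
  by rewrite mxE inordK // gtn_eqF ?mul0r.
rewrite (bigD1 ord0) //= !mxE inordK // eqxx mul1r big1 ?addr0 => [|j neq_j].
  by rewrite (_ : inord 0 = ord0) //; apply/val_inj; rewrite /= inordK.
by rewrite !mxE inordK // eqxx -[nat_of_ord j]/(val j) -val_eqE in neq_j * ;
  rewrite (negPf neq_j) mul0r.
Qed.

(** Two properties are wanted: strict growth, and multiplication by q when k increases by the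
    dimension. On the first period the values are n+1, ..., 2n+1, which stay below q(n+1) because q
    >= 2. *)
Definition beta k := (q ^ (k %/ n.+1) * (n.+1 + k %% n.+1))%N.

Lemma beta_addn k : beta (k + n.+1) = (q * beta k)%N.
Proof. by rewrite /beta modnDr divnDr // divnn /= addn1 expnS mulnA. Qed.

Lemma beta_ltS k : (beta k < beta k.+1)%N.
Proof.
rewrite /beta; have q1 := finNzRing_gt1 F; set N := n.+1.
have lt_kN : (k %% N < N)%N by rewrite ltn_mod.
have pq : (0 < q ^ (k %/ N))%N by rewrite expn_gt0 (ltnW q1).
rewrite {3 4}(divn_eq k N) -addnS.
have [lt_kN1 | le_Nk] := ltnP (k %% N).+1 N.
  rewrite divnMDl // (divn_small lt_kN1) addn0 modnMDl (modn_small lt_kN1) ltn_pmul2l //.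
  by rewrite addnS.
have -> : (k %% N).+1 = N by apply/eqP; rewrite eqn_leq lt_kN.
rewrite divnMDl // divnn /= addn1 modnMDl modnn addn0 expnSr -mulnA ltn_pmul2l //.
by rewrite (@leq_trans (2 * N)) // ?leq_mul2r ?q1 ?orbT // mul2n -addnn ltn_add2l.
Qed.

Lemma beta_leq k l : (k <= l)%N -> (beta k <= beta l)%N.
Proof.
by apply: (homo_leq (fun _ => leqnn _) leq_trans) => i; apply: ltnW (beta_ltS i).
Qed.

Lemma leq_beta k : (k + n.+1 <= beta k)%N.
Proof.
elim: k => [|k IHk]; last by rewrite addSn (leq_ltn_trans IHk) // beta_ltS.
by rewrite /beta div0n mod0n mul1n addn0.
Qed.

Lemma beta_bound k : (beta k <= n.+1.*2 * q ^ k)%N.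
Proof.
rewrite /beta mulnC -addnn leq_mul //.
  by rewrite leq_add2l ltnW // ltn_mod.
by rewrite leq_exp2l ?finNzRing_gt1 // leq_div.
Qed.

(* The filtration is chosen so that t has degree exactly one for it: the
   weight of coordinate i in step j depends on i + j only, and multiplying the
   weights by q shifts their index by the dimension. *)
Definition deg_bounded j (x : V) : Prop :=
  forall i, (i <= n)%N -> (size (coord_at x i) <= (beta (i + j)).+1)%N.

Lemma deg_bounded_leq j l x : (j <= l)%N -> deg_bounded j x -> deg_bounded l x.
Proof.
move=> le_jl xj i le_in; apply: leq_trans (xj i le_in) _.
by rewrite ltnS beta_leq // leq_add2l.
Qed.

Lemma deg_bounded0 j : deg_bounded j 0.
Proof. by move=> i _; rewrite coord_at0 size_poly0. Qed.

Lemma deg_boundedD j x y :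
  deg_bounded j x -> deg_bounded j y -> deg_bounded j (x + y).
Proof.
move=> xj yj i le_in; rewrite coord_atD (leq_trans (size_polyD _ _)) //.
by rewrite geq_max xj ?yj.
Qed.

Lemma deg_boundedZ j c x : deg_bounded j x -> deg_bounded j (c%:P *: x).
Proof.
move=> xj i le_in; rewrite coord_atZ (leq_trans (size_scale_leq _ _)) //.
exact: xj.
Qed.

Lemma deg_bounded_sum j I (r : seq I) (P : pred I) (f : I -> V) :
  (forall i, P i -> deg_bounded j (f i)) -> deg_bounded j (\sum_(i <- r | P i) f i).
Proof.
move=> fj; apply: big_ind => //; first exact: deg_bounded0.
exact: deg_boundedD.
Qed.

Lemma deg_bounded_t j x : deg_bounded j x -> deg_bounded j.+1 ('X *: x).
Proof.
move=> xj i le_in; rewrite coord_at_t // (leq_trans (size_polyD _ _)) //.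
rewrite geq_max; apply/andP; split.
  have [->|x0] := eqVneq (coord_at x i) 0; first by rewrite mulr0 size_poly0.
  by rewrite mulrC size_mulX // ltnS (leq_trans (xj i le_in)) // addnS beta_ltS.
have [lt_in|le_ni] := ltnP i n; first by rewrite -addSnnS xj.
have -> : i = n by apply/eqP; rewrite eqn_leq le_in.
rewrite -addSnnS addnC beta_addn.
have := xj 0 isT; rewrite add0n => x0j.
have [->|x0] := eqVneq (coord_at x 0) 0.
  by rewrite expr0n gtn_eqF ?size_poly0 // ltnW // finNzRing_gt1.
have xq_gt0 : (0 < size (coord_at x 0 ^+ q))%N by rewrite size_poly_gt0 expf_neq0.
rewrite -(prednK xq_gt0) ltnS size_exp mulnC leq_mul2l -ltnS prednK ?size_poly_gt0 //.
by rewrite x0j orbT.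
Qed.

(** The excess of a coordinate over its bound propagates down to coordinate 0, whose q-th power then
    makes the last coordinate exceed its bound as well. Following the degrees around this cycle
    gives a contradiction. *)
Lemma deg_bounded_tI j x : deg_bounded j.+1 ('X *: x) -> deg_bounded j x.
Proof.
move=> txj.
have sizeX (p : {poly F}) : p != 0 -> size ('X * p) = (size p).+1.
  by move=> p0; rewrite mulrC size_mulX.
(* If coordinate i + 1 exceeds its bound, only the term theta x_i can cancel
   its leading monomial. *)
have back (p s : {poly F}) (b : nat) : (size ('X * p + s)%R <= b.+1)%N ->
    (b.+1 < size s)%N -> size s = (size p).+1.
  move=> le_b lt_b; have [p0|p0] := eqVneq p 0.
    by move: le_b; rewrite p0 mulr0 add0r leqNgt lt_b.
  rewrite -(sizeX _ p0); apply/eqP; apply: contraTT le_b => neq_sz.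
  rewrite -ltnNge; move: neq_sz; rewrite neq_ltn => /orP[lt_sz|lt_sz].
    by rewrite size_polyDl // (ltn_trans lt_b).
  by rewrite addrC size_polyDl.
pose bad i := ((beta (i + j)).+1 < size (coord_at x i))%N.
have stepd i : (i < n)%N -> bad i.+1 ->
    size (coord_at x i.+1) = (size (coord_at x i)).+1 /\ bad i.
  move=> lt_in bad_i; have := txj i (ltnW lt_in).
  rewrite coord_at_t ?(ltnW lt_in) // lt_in -addSnnS => /back/(_ bad_i) sz.
  split=> //; move: bad_i; rewrite /bad sz !ltnS addSn; apply: leq_ltn_trans.
  exact: beta_ltS.
have down i : (i <= n)%N -> bad i ->
    size (coord_at x i) = (size (coord_at x 0) + i)%N /\ bad 0.
  elim: i => [|i IHi] le_in; first by rewrite addn0.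
  by case/(stepd _ le_in) => -> /(IHi (ltnW le_in))[-> ]; rewrite addnS.
move=> i le_in; rewrite leqNgt; apply/negP => bad_i.
have [_ bad0] := down i le_in bad_i.
have q1 := finNzRing_gt1 F; have b0 := leq_beta j.
have x0_neq0 : coord_at x 0 != 0 by rewrite -size_poly_gt0 (leq_ltn_trans _ bad0).
have szq : size (coord_at x 0 ^+ q) = ((size (coord_at x 0)).-1 * q).+1.
  by rewrite -size_exp prednK // size_poly_gt0 expf_neq0.
have := txj n (leqnn n); rewrite coord_at_t // ltnn -addSnnS addnC beta_addn.
move=> /back; rewrite szq; move: bad0; rewrite /bad add0n => bad0.
set a := size (coord_at x 0) in bad0 szq *; set Q := q in q1 szq *.
have lt_a : (beta j < a.-1)%N by lia.
have lt_Qa : (Q * beta j < a.-1 * Q)%N by rewrite mulnC ltn_pmul2r // ltnW.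
rewrite !ltnS => /(_ lt_Qa)[szn].
have /down[//|szn' _] : bad n.
  rewrite /bad -szn; have := beta_ltS (n + j).
  by rewrite -addSn [(n.+1 + j)%N]addnC beta_addn => /leq_ltn_trans; apply.
(* If d is the degree of coordinate 0, the cycle yields q d = d + n + 1, so d <= n + 1, whereas d >
   [beta j] >= n + 1. *)
have : (2 * a.-1 <= a.-1 * Q)%N by rewrite mulnC leq_mul2l q1 orbT.
by rewrite szn szn' -/a; lia.
Qed.

Lemma deg_bounded_Xn j d x :
  deg_bounded (j + d) ('X^d *: x) <-> deg_bounded j x.
Proof.
elim: d => [|d IHd]; first by rewrite addn0 expr0 scale1r.
rewrite -IHd addnS exprS -scalerA; split; last exact: deg_bounded_t.
exact: deg_bounded_tI.
Qed.

(** The degree of a is at most d - 1, which turns step j + 1 into step j + d. *)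
Lemma deg_bounded_scale j d (a : {poly F}) x :
  (size a <= d)%N -> deg_bounded j.+1 x -> deg_bounded (j + d) (a *: x).
Proof.
move=> le_ad xj; rewrite -[a]coefK poly_def scaler_suml.
apply: deg_bounded_sum => i _; rewrite -mul_polyC -scalerA; apply: deg_boundedZ.
apply: (@deg_bounded_leq (j.+1 + i)); last exact/deg_bounded_Xn.
by rewrite addSnnS leq_add2l (leq_trans (ltn_ord i)).
Qed.

(* Compare leading coefficients: a relation over F[t] between the w_i yields an
   F-linear relation modulo the previous step of the filtration. *)
Lemma lin_indep_of_graded j k (w : 'I_k -> V) :
  (forall i, deg_bounded j.+1 (w i)) ->
  (forall c : 'I_k -> F, deg_bounded j (\sum_i (c i)%:P *: w i) ->
     forall i, c i = 0) ->
  lin_indep w.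
Proof.
move=> wj free_w a sum0.
suff [d] : exists d, forall i, (size (a i) <= d)%N.
  elim: d => [|d IHd] le_ad; first by move=> i; apply/eqP; rewrite -size_poly_leq0.
  pose b i := take_poly d (a i).
  have aE i : a i = b i + (a i)`_d *: 'X^d.
    apply/polyP => k'; rewrite coefD coef_take_poly coefZ coefXn.
    case: ltngtP => [||->]; rewrite ?mulr0 ?mulr1 ?addr0 ?add0r // => lt_dk.
    by rewrite nth_default // (leq_trans (le_ad i)).
  have top0 : forall i, (a i)`_d = 0.
    apply: free_w; apply/(deg_bounded_Xn _ d).
    (* By the relation, the terms with leading coefficients are minus the lower terms, which lie in
       step j + d; cancelling ['X^d] brings this down to step j. *)
    have -> : 'X^d *: (\sum_i ((a i)`_d)%:P *: w i) =
        \sum_i (-1)%:P *: (b i *: w i).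
      apply/eqP; rewrite -subr_eq0 scaler_sumr -sumrB -[eqbRHS]sum0; apply/eqP.
      apply: eq_bigr => i _.
      rewrite [in RHS]aE scalerDl addrC polyCN scaleNr scale1r opprK.
      by rewrite scalerA mulrC mul_polyC.
    apply: deg_bounded_sum => i _; apply: deg_boundedZ; apply: deg_bounded_scale => //.
    by rewrite size_take_poly.
  apply: IHd => i; rewrite aE top0 scale0r addr0; exact: size_take_poly.
by exists (\max_i size (a i)) => i; apply: (leq_bigmax i).
Qed.

End DegreeFiltration.

(** * Spaces of relations of bounded degree *)

(** Degree bounds are mere propositions; this gives them dimensions. A subspace inside P that misses
    an element of P is enlarged by a line, which can happen only finitely often. *)
Lemma vspace_of_closed (K : fieldType) (vT : vectType K) (P : vT -> Prop) :
  P 0%R -> (forall x y, P x -> P y -> P (x + y)%R) -> (forall a x, P x -> P (a *: x)%R) ->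
  exists U : {vspace vT}, forall x, x \in U <-> P x.
Proof.
move=> P0 PD PZ.
suff [U [UP maxU]] : exists U : {vspace vT},
    (forall x, x \in U -> P x) /\ (forall x, P x -> x \in U).
  by exists U => x; split; [apply: UP | apply: maxU].
have [k] := ubnP (\dim {:vT} - \dim (0%VS : {vspace vT})).
have : forall x, x \in (0%VS : {vspace vT}) -> P x.
  by move=> x; rewrite memv0 => /eqP->.
elim: k (0%VS : {vspace vT}) => // k IHk U UP leUk.
have [maxU|/not_all_ex_not[x notUx]] := classic (forall x, P x -> x \in U).
  by exists U.
have [Px /negP {}notUx] := imply_to_and _ _ notUx.
apply: (IHk (U + <[x]>)%VS) => [y /memv_addP[u Uu [z /vlineP[a ->] ->]]|].
  by apply: PD; [apply: UP | apply: PZ].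
have : (\dim U < \dim (U + <[x]>)%VS).
  rewrite (ltn_leqif (dimv_leqif_sup (addvSl U <[x]>))).
  by apply: contra notUx => /subvP; apply; rewrite memvE addvSr.
have := dimvS (subvf (U + <[x]>)%VS).
by lia.
Qed.

Section RelationSpace.

Variables (F : finFieldType) (n m L : nat).
Local Notation q := #|F|.
Local Notation V := (carlitz_integral F n.+1).
Variable v : 'I_m -> V.
Local Open Scope ring_scope.

(** Row i lists the coefficients of the polynomial in front of v_i, of degree below L, so that
    relations form a finite-dimensional F-space. *)
Definition combine (c : 'M[F]_(m, L)) : V := \sum_i rVpoly (row i c) *: v i.

Lemma combineD c c' : combine (c + c') = combine c + combine c'.
Proof.
rewrite -big_split; apply: eq_bigr => i _ /=.
by rewrite !linearD /= scalerDl.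
Qed.

Lemma combineZ a c : combine (a *: c) = a%:P *: combine c.
Proof.
rewrite scaler_sumr; apply: eq_bigr => i _.
by rewrite !linearZ /= -mul_polyC scalerA mulrC.
Qed.

Lemma combine0 : combine 0 = 0.
Proof. by rewrite -(scale0r 0) combineZ polyC0 scale0r. Qed.

Lemma combine_sum I (r : seq I) P (f : I -> 'M[F]_(m, L)) :
  combine (\sum_(i <- r | P i) f i) = \sum_(i <- r | P i) combine (f i).
Proof. by apply: (big_morph combine); [apply: combineD | apply: combine0]. Qed.

(** A basis of a complement of the common part in U' has images independent modulo step j, hence
    independent over F[t] by [lin_indep_of_graded]; there are at most s of them. *)
Lemma dim_deg_bounded_step s j (U U' : {vspace 'M[F]_(m, L)}) :
  has_rank (span_of v) s ->
  (forall x, x \in U <-> deg_bounded j (combine x)) ->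
  (forall x, x \in U' <-> deg_bounded j.+1 (combine x)) ->
  (\dim U' <= \dim U + s)%N.
Proof.
move=> [_ max_s] UP U'P; pose W := (U' :\: U)%VS.
rewrite -(dimv_cap_compl U' U) leq_add ?dimvS ?capvSr //.
have memW i : (vbasis W)`_i \in W.
  have [lt_i|le_i] := ltnP i (size (vbasis W)); first by rewrite vbasis_mem ?mem_nth.
  by rewrite nth_default ?mem0v.
pose w (i : 'I_(\dim W)) := combine (vbasis W)`_i.
apply: (max_s _ w) => [i|]; first by exists (fun k => rVpoly (row k (vbasis W)`_i)).
apply: (@lin_indep_of_graded _ _ j) => [i|c].
  by apply/U'P; apply: subvP (diffvSl U' U) _ (memW i).
have -> : \sum_i (c i)%:P *: w i = combine (\sum_i c i *: (vbasis W)`_i).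
  by rewrite combine_sum; apply: eq_bigr => i _; rewrite combineZ.
have /freeP freeW := basis_free (vbasisP W); move/UP => sumU; apply: freeW.
apply/eqP; rewrite -memv0 -(capv_diff U' U) memv_cap sumU andbT.
by rewrite rpred_sum // => i _; rewrite rpredZ.
Qed.

Lemma vspace_deg_bounded j : exists U : {vspace 'M[F]_(m, L)},
  forall x, x \in U <-> deg_bounded j (combine x).
Proof.
apply: vspace_of_closed => [|x y|a x].
- by rewrite combine0; apply: deg_bounded0.
- by rewrite combineD; apply: deg_boundedD.
- by rewrite combineZ; apply: deg_boundedZ.
Qed.

(** In step 0 coordinate i has degree at most n+1+i <= 2n+1, so 2(n+1) coefficients for each of the
    n+1 coordinates determine [combine x]. *)
Lemma dim_deg_bounded0 (U K : {vspace 'M[F]_(m, L)}) :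
  (forall x, x \in U <-> deg_bounded 0 (combine x)) ->
  (forall x, x \in K <-> combine x = 0) ->
  (\dim U <= \dim K + n.+1 * n.+1.*2)%N.
Proof.
move=> UP KP.
pose g (x : 'M[F]_(m, L)) : 'M[F]_(n.+1, n.+1.*2) :=
  \matrix_(i, k) (coord_at (combine x) i)`_k.
have g_lin : linear g.
  move=> a x y; apply/matrixP => i k.
  by rewrite !mxE combineD combineZ coord_atD coord_atZ coefD coefZ.
pose f : {linear 'M[F]_(m, L) -> 'M[F]_(n.+1, n.+1.*2)} :=
  HB.pack g (GRing.isLinear.Build _ _ _ _ g g_lin).
rewrite -(limg_ker_dim (linfun f) U) leq_add //; last first.
  by rewrite (leq_trans (dimvS (subvf _))) // dimvf.
apply/dimvS/subvP => x; rewrite memv_cap memv_ker lfunE /=.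
case/andP => /UP x_bd /eqP gx0; apply/KP/coord_at_inj => i le_in.
rewrite coord_at0; apply/polyP => k; rewrite coef0.
have [lt_k|le_k] := ltnP k n.+1.*2.
  have := congr1 (fun M : 'M_(_, _) => M (Ordinal (le_in : i < n.+1)%N) (Ordinal lt_k)) gx0.
  by rewrite !mxE.
rewrite nth_default // (leq_trans (x_bd i le_in)) // (leq_trans _ le_k) //.
by rewrite addn0 /beta divn_small // modn_small // mul1n -addnn -addnS leq_add2l.
Qed.

(** All of the mL-dimensional coefficient space is mapped into step J + L, and each step from 0 on
    costs at most s dimensions. *)
Lemma dim_relations_ge s J (K : {vspace 'M[F]_(m, L)}) :
  has_rank (span_of v) s -> (forall i, deg_bounded J.+1 (v i)) ->
  (forall x, x \in K <-> combine x = 0) ->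
  (m * L <= \dim K + n.+1 * n.+1.*2 + s * (J + L))%N.
Proof.
move=> rank_s vJ KP.
have bound j (U : {vspace 'M[F]_(m, L)}) :
    (forall x, x \in U <-> deg_bounded j (combine x)) ->
    (\dim U <= \dim K + n.+1 * n.+1.*2 + s * j)%N.
  elim: j U => [|j IHj] U UP; first by rewrite muln0 addn0 dim_deg_bounded0.
  have [U' U'P] := vspace_deg_bounded j.
  rewrite mulnSr addnA (leq_trans (dim_deg_bounded_step rank_s U'P UP)) //.
  by rewrite leq_add2r IHj.
have [U UP] := vspace_deg_bounded (J + L).
rewrite -[(m * L)%N]/(dim 'M[F]_(m, L)) -dimvf (leq_trans _ (bound _ _ UP)) //.
apply/dimvS/subvP => x _; apply/UP; apply: deg_bounded_sum => i _.
by apply: deg_bounded_scale (vJ i); apply: size_poly.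
Qed.

(** A relation is determined by its rows outside I: the difference of two relations that agree there
    is a relation supported in I, hence zero. *)
Lemma card_relations_le (I : {set 'I_m}) : indep_on v I ->
  (#|[set c | combine c == 0%R]| <= q ^ ((m - #|I|) * L))%N.
Proof.
move=> freeI.
pose rest (c : 'M[F]_(m, L)) : {ffun {i | i \notin I} -> 'rV[F]_L} :=
  [ffun i => row (val i) c].
have rest_inj : {in [set c | combine c == 0] &, injective rest}.
  move=> c c'; rewrite !inE => /eqP c0 /eqP c'0 /ffunP eq_rest.
  apply/eqP; rewrite -subr_eq0; apply/eqP; set d := c - c'.
  have d0 : combine d = 0.
    by rewrite /d -scaleN1r combineD combineZ c0 c'0 scaler0 addr0.
  have rowd i : i \notin I -> row i d = 0.
    move=> Ii; have := eq_rest (exist _ i Ii); rewrite !ffunE /= => eq_row.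
    by rewrite linearB /= eq_row subrr.
  apply/row_matrixP => i; rewrite row0 -[row i d]rVpolyK.
  rewrite (freeI (fun i => rVpoly (row i d)) _ d0) ?linear0 // => k /rowd ->.
  by rewrite linear0.
rewrite -(card_in_imset rest_inj) (leq_trans (max_card _)) // card_ffun card_mx.
rewrite card_sig mul1n -expnM mulnC.
rewrite (_ : #|[pred i | i \notin I]| = (m - #|I|)%N) //.
by rewrite -[m in (m - _)%N]card_ord -(cardC I) addKn; apply: eq_card.
Qed.

Lemma card_relations_gt s J :
  has_rank (span_of v) s -> (forall i, deg_bounded J.+1 (v i)) -> (s < m)%N ->
  (n.+1 * n.+1.*2 + s * J < L)%N ->
  (q ^ ((m - s).-1 * L) < #|[set c | combine c == 0%R]|)%N.
Proof.
move=> rank_s vJ lt_sm ltL.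
have [K KP] : exists K : {vspace 'M[F]_(m, L)}, forall x, x \in K <-> combine x = 0.
  apply: vspace_of_closed => [|x y|a x]; first exact: combine0.
    by rewrite combineD => -> ->; rewrite addr0.
  by rewrite combineZ => ->; rewrite scaler0.
have -> : #|[set c | combine c == 0]| = #|K|.
  by apply: eq_card => c; rewrite inE; apply/eqP/idP => /KP.
rewrite (@card_vspace F 'M[F]_(m, L) (Vector.class _) K).
rewrite ltn_exp2l ?finNzRing_gt1 //; have := dim_relations_ge rank_s vJ KP.
move: (\dim K) (n.+1 * n.+1.*2)%N ltL => d N ltL.
have -> : (m * L = ((m - s).-1 * L + L) + s * L)%N.
  by rewrite addnC -mulSnr -mulnDl; congr (_ * _)%N; lia.
by rewrite mulnDr; lia.
Qed.

End RelationSpace.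

(** * Decoding the input *)

Section Digits.

Variable b : nat.
Hypothesis b_gt1 : 1 < b.

Definition digit z p := z %/ b ^ p %% b.

Definition of_digits N (d : nat -> nat) := \sum_(0 <= p < N) d p * b ^ p.

Lemma digit_lt z p : digit z p < b.
Proof. by rewrite ltn_mod ltnW. Qed.

Lemma digit0 p : digit 0 p = 0.
Proof. by rewrite /digit div0n mod0n. Qed.

Lemma of_digitsS N d : of_digits N.+1 d = of_digits N (d \o succn) * b + d 0.
Proof.
rewrite /of_digits big_nat_recl // expn0 muln1 addnC big_distrl /=.
by congr (_ + _); apply: eq_bigr => p _; rewrite expnSr mulnA.
Qed.

Lemma digitS z p : digit z p.+1 = digit (z %/ b) p.
Proof. by rewrite /digit expnS divnMA. Qed.

Lemma of_digits_lt N d : (forall p, d p < b) -> of_digits N d < b ^ N.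
Proof.
elim: N d => [|N IHN] d d_lt; first by rewrite /of_digits big_nil.
rewrite of_digitsS expnSr; have := IHN _ (fun p => d_lt p.+1); have := d_lt 0.
by move: (of_digits _ _) => /= x; nia.
Qed.

Lemma digit_of_digits N d p : (forall p, d p < b) -> p < N ->
  digit (of_digits N d) p = d p.
Proof.
elim: N d p => // N IHN d [|p] d_lt lt_pN; rewrite of_digitsS.
  by rewrite /digit expn0 divn1 modnMDl modn_small.
rewrite digitS divnMDl ?(ltnW b_gt1) // divn_small // addn0.
exact: (IHN (d \o succn) p (fun p => d_lt p.+1)).
Qed.

Lemma of_digits_digit N z : z < b ^ N -> of_digits N (digit z) = z.
Proof.
elim: N z => [|N IHN] z; first by rewrite /of_digits big_nil; case: z.
move=> lt_z; rewrite of_digitsS [RHS](divn_eq z b); congr (_ * _ + _).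
  rewrite -[RHS]IHN; first by apply: eq_bigr => p _ /=; rewrite digitS.
  by rewrite ltn_divLR ?(ltnW b_gt1) // -expnSr.
by rewrite /digit expn0 divn1.
Qed.

End Digits.

Lemma computable_digit b : computable2 (digit b).
Proof. by rewrite /computable2 /digit; computability. Qed.

(* CodeSeq.code (x :: s) = 2 ^ x * (2 * CodeSeq.code s).+1 *)
Definition val2 c := \sum_(0 <= e < c) (c %% 2 ^ e.+1 == 0).
Definition code_behead c := c %/ 2 ^ (val2 c).+1.
Definition code_drop i c := nat_rect (fun=> nat) c (fun _ r => code_behead r) i.

(* The entry shifted by one, and 0 beyond the end of the sequence. *)
Definition code_nth c i :=
  if code_drop i c == 0 then 0 else (val2 (code_drop i c)).+1.
Definition code_size c := \sum_(0 <= i < c) (0 < code_nth c i).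

Lemma computable_val2 : computable1 val2.
Proof. by rewrite /computable1 /val2; computability. Qed.

Ltac computable_call ::=
  apply: (mu_computes_call1 computable_val2).

Lemma computable_code_behead : computable1 code_behead.
Proof. by rewrite /computable1 /code_behead; computability. Qed.

Ltac computable_call ::= first
  [ apply: (mu_computes_call1 computable_val2)
  | apply: (mu_computes_call1 computable_code_behead) ].

Lemma computable_code_drop : computable2 code_drop.
Proof. by rewrite /computable2 /code_drop; computability. Qed.

Ltac computable_call ::= first
  [ apply: (mu_computes_call1 computable_val2)
  | apply: (mu_computes_call2 computable_code_drop) ].

Lemma computable_code_nth : computable2 code_nth.
Proof. by rewrite /computable2 /code_nth; computability. Qed.

Ltac computable_call ::= apply: (mu_computes_call2 computable_code_nth).

Lemma computable_code_size : computable1 code_size.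
Proof. by rewrite /computable1 /code_size; computability. Qed.

Lemma code_cons x s : CodeSeq.code (x :: s) = 2 ^ x * (CodeSeq.code s).*2.+1.
Proof. by []. Qed.

(** With [mem_ltn_code], this makes a code a sufficient search bound in [val2] and [code_size], and
    a bound for the number of generators and their degrees. *)
Lemma size_leq_code s : size s <= CodeSeq.code s.
Proof.
elim: s => // x s IHs; rewrite code_cons /=.
rewrite (leq_trans _ (leq_pmull _ _)) ?expn_gt0 // ltnS -addnn.
by rewrite (leq_trans IHs) // leq_addr.
Qed.

Lemma mem_ltn_code s x : x \in s -> x < CodeSeq.code s.
Proof.
elim: s => // y s IHs; rewrite inE code_cons => /orP[/eqP->|/IHs lt_x].
  by rewrite (leq_trans (ltn_expl y (isT : 1 < 2))) // leq_pmulr.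
rewrite (leq_trans _ (leq_pmull _ _)) ?expn_gt0 // ltnS -addnn.
by rewrite (leq_trans (ltnW lt_x)) // leq_addr.
Qed.

Lemma val2_code x s : val2 (CodeSeq.code (x :: s)) = x.
Proof.
rewrite /val2 -[RHS](@sum_nat_ltn x (CodeSeq.code (x :: s))); last first.
  by rewrite ltnW // mem_ltn_code // mem_head.
apply: eq_bigr => e _; rewrite code_cons -/(dvdn _ _).
have [lt_ex|le_xe] := ltnP e x; first by rewrite dvdn_mulr // dvdn_exp2l.
apply/eqP; rewrite eqb0; apply/negP => dvd_e.
have : 2 ^ x.+1 %| 2 ^ x * (CodeSeq.code s).*2.+1.
  by apply: dvdn_trans dvd_e; rewrite dvdn_exp2l.
by rewrite expnSr dvdn_pmul2l ?expn_gt0 // dvdn2 /= odd_double.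
Qed.

(** Division by 2^(x+1) rounds 2^x (2 r + 1) down to r; the empty sequence has code 0, which is
    fixed. *)
Lemma code_behead_code s : code_behead (CodeSeq.code s) = CodeSeq.code (behead s).
Proof.
case: s => [|x s]; first exact: div0n.
rewrite /code_behead val2_code code_cons expnSr.
by rewrite divnMl ?expn_gt0 // -muln2 -addn1 divnMDl // addn0.
Qed.

Lemma code_drop_code i s : code_drop i (CodeSeq.code s) = CodeSeq.code (drop i s).
Proof.
elim: i => [|i IHi]; first by rewrite drop0.
by rewrite /= -/(code_drop i _) IHi code_behead_code -drop1 drop_drop.
Qed.

Lemma code_nth_code s i : code_nth (CodeSeq.code s) i =
  if i < size s then (nth 0 s i).+1 else 0.
Proof.
rewrite /code_nth code_drop_code; have [lt_i|le_i] := ltnP i (size s).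
  rewrite (drop_nth 0 lt_i) val2_code ifF //; apply/eqP.
  by apply/eqP; rewrite -lt0n code_cons muln_gt0 expn_gt0.
by rewrite drop_oversize.
Qed.

Lemma code_size_code s : code_size (CodeSeq.code s) = size s.
Proof.
rewrite /code_size -[RHS](@sum_nat_ltn _ (CodeSeq.code s)) ?size_leq_code //.
by apply: eq_bigr => i _; rewrite code_nth_code; case: (i < size s).
Qed.

(** * The algorithm *)

Section RankAlgorithm.

Variable F : finFieldType.
Local Notation q := #|F|.

(* The elements of F, numbered so that 0 stands for zero. *)
Definition elts : seq F := 0%R :: [seq x <- enum F | x != 0%R].
Definition elt a : F := nth 0%R elts a.
Definition num (x : F) : nat := index x elts.

Lemma uniq_elts : uniq elts.
Proof. by rewrite /elts /= mem_filter eqxx filter_uniq ?enum_uniq. Qed.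

Lemma mem_elts x : x \in elts.
Proof. by rewrite inE mem_filter mem_enum andbT orbN. Qed.

Lemma size_elts : size elts = q.
Proof.
rewrite cardE; apply: perm_size; apply: uniq_perm uniq_elts (enum_uniq _) _ => x.
by rewrite mem_elts mem_enum.
Qed.

Lemma num_lt x : num x < q.
Proof. by rewrite -size_elts index_mem mem_elts. Qed.

Lemma numK : cancel num elt.
Proof. by move=> x; apply: nth_index; apply: mem_elts. Qed.

Lemma eltK a : a < q -> num (elt a) = a.
Proof. by move=> lt_a; apply: index_uniq uniq_elts; rewrite size_elts. Qed.

Lemma elt0 : elt 0 = 0%R. Proof. by []. Qed.

Lemma num0 : num 0%R = 0.
Proof. by rewrite /num /elts /= eqxx. Qed.

Lemma elt_minn a : elt (minn a q) = elt a.
Proof.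
rewrite /elt; case: leqP => // lt_qa.
by rewrite !nth_default ?size_elts // ltnW.
Qed.

Definition fadd a b := num (elt a + elt b)%R.
Definition fmul a b := num (elt a * elt b)%R.

Lemma fadd_lt a b : fadd a b < q. Proof. exact: num_lt. Qed.
Lemma elt_fadd a b : elt (fadd a b) = (elt a + elt b)%R. Proof. exact: numK. Qed.
Lemma elt_fmul a b : elt (fmul a b) = (elt a * elt b)%R. Proof. exact: numK. Qed.

Lemma computable_fadd : computable2 fadd.
Proof.
apply: (@computable_finite2 q) => [a b|a]; first by rewrite /fadd elt_minn.
by apply: (@computable_finite1 q) => b; rewrite /fadd elt_minn.
Qed.

Lemma computable_fmul : computable2 fmul.
Proof.
apply: (@computable_finite2 q) => [a b|a]; first by rewrite /fmul elt_minn.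
by apply: (@computable_finite1 q) => b; rewrite /fmul elt_minn.
Qed.

(** The input numbers F by [enum_rank], where zero need not come first, and [code_nth] adds one. A
    missing coefficient is read as zero. *)
Definition num_of_rank a := if a is r.+1 then num (nth 0%R (enum F) r) else 0.

Lemma computable_num_of_rank : computable1 num_of_rank.
Proof.
apply: (@computable_finite1 q.+1) => -[|a] //; rewrite minnSS /=.
case: leqP => // lt_qa.
by rewrite !nth_default // -?cardE // ltnW.
Qed.

(** The predecessors undo the shift of [code_nth] for points and coordinates; for coefficients it is
    kept, since k may lie beyond the end. *)
Definition input_coef c i j k :=
  num_of_rank (code_nth (code_nth (code_nth c i).-1 j).-1 k).

(** Exceeds s J + dim B_0 with J = c: both s and J are at most c, and dim B_0 is at most 2 n^2 in
    dimension n. *)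
Definition rel_len n c := c * c + n * (n + n) + 1.
(** By [beta_bound], larger than every degree allowed in step c + [rel_len n c], where all
    combinations under test lie. *)
Definition pol_len n c := (n + n) * q ^ (n + c + rel_len n c) + 1.

(* Digit j * D + k of a state, where D = pol_len n c, is the coefficient of
   theta ^ k in coordinate j; coefficients from theta ^ D on are dropped.  The
   q-th power of a polynomial over F only spreads out its coefficients. *)
Definition step_digit n c z l st p :=
  fadd
    (fadd (if p %% pol_len n c == 0 then 0 else digit q st p.-1)
       (if (p %/ pol_len n c).+1 < n then digit q st (p + pol_len n c)
        else if p %% pol_len n c %% q == 0 then digit q st (p %% pol_len n c %/ q)
        else 0))
    (nat_rect (fun=> nat) 0
       (fun i r => fadd r (fmul (digit q z (i * rel_len n c + l))
          (input_coef c i (p %/ pol_len n c) (p %% pol_len n c))))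
       (code_size c)).

Definition step n c z l st :=
  \sum_(0 <= p < n * pol_len n c) step_digit n c z l st p * q ^ p.

(** Horner's rule reads the coefficients from the highest power of t downwards, hence the reversed
    index. *)
Definition run n c z i := nat_rect (fun=> nat) 0
  (fun i st => step n c z (rel_len n c - i.+1) st) i.

Definition count_relations n c :=
  \sum_(0 <= z < q ^ (code_size c * rel_len n c)) (run n c z (rel_len n c) == 0).

(** For m generators of rank s the inequality holds exactly when e < m - s, so the sum is m - s. *)
Definition rank_alg n c := code_size c -
  \sum_(0 <= e < code_size c) (q ^ (e * rel_len n c) < count_relations n c).

Ltac computable_call ::= first
  [ apply: (mu_computes_call2 computable_code_nth)
  | apply: (mu_computes_call1 computable_code_size)
  | apply: (mu_computes_call1 computable_num_of_rank) ].

Lemma computable_input_coef : computable4 input_coef.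
Proof. by rewrite /computable4 /input_coef; computability. Qed.

Lemma computable_rel_len : computable2 rel_len.
Proof. by rewrite /computable2 /rel_len; computability. Qed.

Ltac computable_call ::= first
  [ apply: (mu_computes_call2 computable_rel_len)
  | apply: (mu_computes_call1 computable_code_size) ].

Lemma computable_pol_len : computable2 pol_len.
Proof. by rewrite /computable2 /pol_len; computability. Qed.

Ltac computable_call ::= first
  [ apply: (mu_computes_call2 computable_rel_len)
  | apply: (mu_computes_call2 computable_pol_len)
  | apply: (mu_computes_call1 computable_code_size)
  | apply: (mu_computes_call2 (computable_digit q))
  | apply: (mu_computes_call2 computable_fadd)
  | apply: (mu_computes_call2 computable_fmul)
  | apply: (mu_computes_call4 computable_input_coef) ].

Lemma computable_step_digit : computable6 step_digit.
Proof. by rewrite /computable6 /step_digit; computability. Qed.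

Ltac computable_call ::= first
  [ apply: (mu_computes_call2 computable_pol_len)
  | apply: (mu_computes_call6 computable_step_digit) ].

Lemma computable_step : computable5 step.
Proof. by rewrite /computable5 /step; computability. Qed.

Ltac computable_call ::= first
  [ apply: (mu_computes_call2 computable_rel_len)
  | apply: (mu_computes_call5 computable_step) ].

Lemma computable_run : computable4 run.
Proof. by rewrite /computable4 /run; computability. Qed.

Ltac computable_call ::= first
  [ apply: (mu_computes_call2 computable_rel_len)
  | apply: (mu_computes_call1 computable_code_size)
  | apply: (mu_computes_call4 computable_run) ].

Lemma computable_count_relations : computable2 count_relations.
Proof. by rewrite /computable2 /count_relations; computability. Qed.

Ltac computable_call ::= first
  [ apply: (mu_computes_call2 computable_rel_len)
  | apply: (mu_computes_call1 computable_code_size)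
  | apply: (mu_computes_call2 computable_count_relations) ].

Lemma computable_rank_alg : computable2 rank_alg.
Proof. by rewrite /computable2 /rank_alg; computability. Qed.
End RankAlgorithm.

(** * Correctness *)

(** As a^q = a for a in F, the q-th power of p is p with X replaced by X^q. *)
Lemma coef_expr_card (F : finFieldType) (p : {poly F}) k :
  ((p ^+ #|F|)`_k)%R = if #|F| %| k then (p`_(k %/ #|F|))%R else 0%R.
Proof.
suff -> : (p ^+ #|F| = p \Po 'X^#|F|)%R 
  by rewrite coef_comp_poly_Xn // ltnW // finNzRing_gt1.
have pchar_F : [pchar {poly F}]%R.-nat #|F|.
  have [p0 p0_pr charFp] := finPcharP F.
  have pF : p0.-nat #|F|.
    by have /abelem_pgroup := fin_ring_pchar_abelem charFp; rewrite /pgroup cardsT.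
  by apply: sub_in_pnat pF => r _ /eqP ->; rewrite pchar_lalg.
elim/poly_ind: p => [|p a IHp].
  by rewrite comp_poly0 expr0n gtn_eqF // ltnW // finNzRing_gt1.
rewrite comp_polyD comp_polyM comp_polyX comp_polyC exprDn_pchar // exprMn IHp.
by rewrite -rmorphXn /= expf_card.
Qed.

Lemma drop_polyS (R : nzRingType) (a : {poly R}) l :
  drop_poly l a = ('X * drop_poly l.+1 a + (a`_l)%:P)%R.
Proof.
apply/polyP => k; rewrite coefD coefXM coefC !coef_drop_poly.
by case: k => [|k] /=; rewrite ?add0r ?addr0 // addnS addSn.
Qed.

Section Correctness.

Variables (F : finFieldType) (n m : nat) (v : 'I_m -> carlitz_integral F n.+1).
Local Notation q := #|F|.
Local Notation V := (carlitz_integral F n.+1).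
Local Notation c := (code_points v).
Local Notation L := (rel_len n.+1 c).
Local Notation D := (pol_len F n.+1 c).

Let q_gt1 : 1 < q := finNzRing_gt1 F.

Lemma code_size_points : code_size c = m.
Proof. by rewrite code_size_code size_map size_enum_ord. Qed.

Lemma input_coefE (i : 'I_m) j k : j <= n ->
  input_coef F c i j k = num ((coord_at (v i) j)`_k)%R.
Proof.
move=> le_jn; rewrite /input_coef code_nth_code size_map size_enum_ord ltn_ord.
rewrite (nth_map i) ?size_enum_ord // nth_ord_enum /=.
rewrite code_nth_code size_map size_enum_ord ltnS le_jn.
rewrite (nth_map ord0) ?size_enum_ord //= (_ : nth _ _ _ = inord j); last first.
  by apply/val_inj; rewrite /= nth_enum_ord // inordK.
rewrite code_nth_code size_map -/(coord_at (v i) j).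
case: ltnP => [lt_k|le_k]; last by rewrite nth_default // num0.
by rewrite (nth_map 0%R) //= nth_enum_rank.
Qed.

Lemma leq_size_code : m <= c.
Proof. by rewrite -{1}code_size_points code_size_code size_leq_code. Qed.

Lemma size_coord_leq_code i j : j <= n -> size (coord_at (v i) j) <= c.
Proof.
move=> le_jn; apply: (@leq_trans (code_poly (coord_at (v i) j))).
  by rewrite (leq_trans _ (size_leq_code _)) // size_map.
apply: (@leq_trans (code_point (v i))); apply/ltnW/mem_ltn_code.
  by apply/mapP; exists (inord j) => //; rewrite mem_enum.
by apply/mapP; exists i => //; rewrite mem_enum.
Qed.

Lemma deg_bounded_input i : deg_bounded c.+1 (v i).
Proof.
move=> j le_jn; rewrite (leq_trans (size_coord_leq_code i le_jn)) //.
have := leq_beta F n (j + c.+1); lia.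
Qed.

(** Agreement modulo theta^D suffices as an invariant: coefficient k of t x depends only on
    coefficients of x of index at most k, so truncation does no harm along the way. *)
Definition represents st (x : V) : Prop := forall j k, j <= n -> k < D ->
  elt F (digit q st (j * D + k)) = ((coord_at x j)`_k)%R.

Lemma elt_sum (f : nat -> nat) l :
  elt F (nat_rect (fun=> nat) 0 (fun i r => fadd F r (f i)) l) =
  (\sum_(0 <= i < l) elt F (f i))%R.
Proof.
elim: l => [|l IHl] /=; first by rewrite big_nil.
by rewrite elt_fadd IHl big_nat_recr.
Qed.

Lemma pol_len_gt0 : 0 < D. Proof. by rewrite /pol_len addn1. Qed.

Lemma represents_step z l st x : represents st x ->
  represents (step F n.+1 c z l st)
    ('X *: x + \sum_(i < m) (elt F (digit q z (i * L + l)%N))%:P *: v i)%R.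
Proof.
move=> st_x j k le_jn lt_kD; have D0 := pol_len_gt0.
rewrite (@digit_of_digits q q_gt1 _ (step_digit F n.+1 c z l st)); last 2 first.
- by move=> p; apply: fadd_lt.
- by rewrite (@leq_trans (j * D + D)) ?ltn_add2l // -mulSnr leq_mul2r ltnS le_jn orbT.
rewrite /step_digit divnMDl // (divn_small lt_kD) addn0 modnMDl (modn_small lt_kD).
rewrite elt_fadd coord_atD coefD elt_fadd coord_at_t // coefD coefXM.
congr (_ + _ + _)%R.
- case: eqP => [//|/eqP k0]; rewrite -(prednK (n := k)) ?lt0n //.
  by rewrite addnS /= st_x // prednK ?lt0n // ltnW.
- rewrite ltnS; have [lt_jn|le_nj] := ltnP j n.
    by rewrite addnAC -mulSnr st_x.
  rewrite coef_expr_card -/(dvdn _ _); case: ifP => // _.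
  by rewrite -[X in digit _ _ X]add0n -[X in X + _](mul0n D) st_x // (leq_ltn_trans (leq_div _ _)).
rewrite code_size_points elt_sum big_mkord coord_at_sum coef_sum.
apply: eq_bigr => i _.
by rewrite elt_fmul input_coefE // numK coord_atZ coefZ.
Qed.

Definition relation_of z : 'M[F]_(m, L) :=
  (\matrix_(i, l) elt F (digit q z (i * L + l)%N))%R.

Lemma represents_run z i : i <= L -> represents (run F n.+1 c z i)
  (\sum_a drop_poly (L - i)%N (rVpoly (row a (relation_of z))) *: v a)%R.
Proof.
elim: i => [_ j k le_jn lt_kD|i IHi lt_iL].
  rewrite digit0 elt0 big1 ?coord_at0 ?coef0 // => a _.
  by rewrite subn0 drop_poly_eq0 ?scale0r // size_poly.
rewrite -[run _ _ _ _ i.+1]/(step F n.+1 c z (L - i.+1) (run F n.+1 c z i)).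
have := represents_step z (L - i.+1) (IHi (ltnW lt_iL)).
congr represents; rewrite scaler_sumr -big_split; apply: eq_bigr => a _ /=.
rewrite [in RHS]drop_polyS -subSn // subSS scalerDl scalerA.
have lt_l : L - i.+1 < L by lia.
by rewrite (coef_rVpoly_ord _ (Ordinal lt_l)) !mxE.
Qed.

Lemma rel_len_gt0 : 0 < L. Proof. by rewrite /rel_len addn1. Qed.

(** The combination lies in step c + L, where degrees are below D, so nothing is truncated in the
    end. Conversely, the state has only (n+1) D digits, and all of them are 0 when the combination
    vanishes. *)
Lemma run_eq0 z : (run F n.+1 c z L == 0) = (combine v (relation_of z) == 0%R).
Proof.
have := represents_run z (leqnn L); rewrite subnn.
have -> : (\sum_a drop_poly 0 (rVpoly (row a (relation_of z))) *: v a =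
    combine v (relation_of z))%R.
  by apply: eq_bigr => a _; rewrite drop_poly0l.
set x := combine v _; set st := run _ _ _ _ _ => st_x.
have st_lt : st < q ^ (n.+1 * D).
  rewrite /st -(prednK rel_len_gt0); apply: of_digits_lt => // p; exact: fadd_lt.
apply/eqP/eqP => [st0|x0].
  apply: coord_at_inj => j le_jn; rewrite coord_at0; apply/polyP => k.
  have [lt_kD|le_Dk] := ltnP k D; first by rewrite -st_x // st0 digit0 coef0.
  rewrite coef0 nth_default // (leq_trans _ le_Dk) //.
  have: deg_bounded (c + L) x.
    apply: deg_bounded_sum => i _.
    by apply: deg_bounded_scale (deg_bounded_input i); apply: size_poly.
  move/(_ j le_jn)/leq_trans; apply; rewrite /pol_len addn1 ltnS.
  rewrite (leq_trans (beta_bound _ _ _)) // addnn leq_mul2l leq_exp2l //.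
  by rewrite addnA !leq_add2r leqW ?orbT.
rewrite -(of_digits_digit q_gt1 st_lt) /of_digits big_nat big1 // => p lt_p.
have lt_j : p %/ D < n.+1 by rewrite ltn_divLR // pol_len_gt0.
have := st_x (p %/ D) (p %% D) lt_j (ltn_pmod _ pol_len_gt0).
rewrite -divn_eq x0 coord_at0 coef0 => /(congr1 (@num F)).
by rewrite eltK ?digit_lt // num0 => ->.
Qed.

(** [relation_of] is injective below q^(m L) by uniqueness of digits, and there are equally many
    matrices. *)
Lemma count_relationsE : count_relations F n.+1 c =
  #|[set a : 'M[F]_(m, L) | combine v a == 0%R]|.
Proof.
rewrite /count_relations code_size_points big_mkord.
pose g (z : 'I_(q ^ (m * L))) := relation_of z.
have g_inj : injective g.
  move=> z1 z2 /matrixP eq_g; apply/val_inj => /=.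
  rewrite -(of_digits_digit q_gt1 (ltn_ord z1)) -(of_digits_digit q_gt1 (ltn_ord z2)).
  rewrite /of_digits big_nat [RHS]big_nat; apply: eq_bigr => p lt_p; congr (_ * _).
  have lt_i : p %/ L < m by rewrite ltn_divLR // rel_len_gt0.
  have := eq_g (Ordinal lt_i) (Ordinal (ltn_pmod p rel_len_gt0)); rewrite !mxE /=.
  by rewrite -divn_eq => /(congr1 (@num F)); rewrite !eltK ?digit_lt.
have g_bij : bijective g by apply: inj_card_bij => //; rewrite card_mx card_ord.
rewrite -(on_card_preimset (onW_bij _ g_bij)) -sum1_card [RHS]big_mkcond /=.
by apply: eq_bigr => z _; rewrite !inE run_eq0; case: eqP.
Qed.

Lemma rank_algP : has_rank (span_of v) (rank_alg F n.+1 c).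
Proof.
have [I freeI maxI] := exists_maximal_indep_on v.
have rankI := has_rank_maximal_indep_on freeI maxI.
suff -> : rank_alg F n.+1 c = #|I| by [].
have le_Im : #|I| <= m by rewrite -[m in _ <= m]card_ord max_card.
rewrite /rank_alg count_relationsE code_size_points.
rewrite (eq_big_nat _ _ (F2 := fun e => nat_of_bool (e < m - #|I|))) => [|e _].
  by rewrite sum_nat_ltn ?leq_subr // subKn.
congr nat_of_bool; have [lt_e|le_e] := ltnP e (m - #|I|).
  have lt_Im : #|I| < m by lia.
  have ltL : n.+1 * n.+1.*2 + #|I| * c < L.
    have := leq_mul (leq_trans le_Im leq_size_code) (leqnn c).
    by rewrite /rel_len -addnn; lia.
  rewrite (leq_ltn_trans _ (card_relations_gt rankI deg_bounded_input lt_Im ltL)) //.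
  by rewrite leq_exp2l // leq_mul2r; apply/orP; right; lia.
apply/negbTE; rewrite -leqNgt (leq_trans (card_relations_le L freeI)) //.
by rewrite leq_exp2l // leq_mul2r le_e orbT.
Qed.

End Correctness.

Theorem theorem6p1 (F : finFieldType) :
  exists alg : mu_rec 2,
    forall (n m : nat) (v : 'I_m -> carlitz_integral F n), (0 < n)%N ->
      exists2 r : nat,
        mu_eval alg [tuple n; code_points v] r & has_rank (span_of v) r.
Proof.
(* The scheme depends on F alone: the dimension is an argument, and the number of generators is read
   from the code. *)
have [alg algP] := computable_rank_alg F; exists alg => -[|n] m v // _.
exists (rank_alg F n.+1 (code_points v)); last exact: rank_algP.
exact: (algP [tuple n.+1; code_points v]).
Qed.
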